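(* Let $\varrho^N$ and $\varrho$ be the Carnot--Carath\'eodory distances on the stratified group $N$ and on $G=N\rtimes\mathbb{R}$ described in the context. For all $(z_0,u_0),(z_1,u_1)\in G$, $$\varrho((z_0,u_0),(z_1,u_1))=\operatorname{arccosh}\frac{1+e^{2(u_1-u_0)}+(e^{-u_0}\varrho^N(z_0,z_1))^2}{2e^{u_1-u_0}}=\operatorname{arccosh}\Big(\cosh(u_0-u_1)+e^{-(u_0+u_1)}\varrho^N(z_0,z_1)^2/2\Big).$$
   Context: $N$ is a stratified group: a simply connected Lie group whose Lie algebra $\mathfrak{n}$ is endowed with a derivation $D$ such that the eigenspace of $D$ of eigenvalue $1$ (the first layer) generates $\mathfrak{n}$ as a Lie algebra; the eigenvalues of $D$ are then positive integers and $\mathfrak{n}$ is the direct sum of the eigenspaces. $N$ is identified with $\mathfrak n$ via the exponential map. It is assumed that the homogeneous dimension $Q=\operatorname{tr}D$ is $\ge2$. $G=N\rtimes A$, $A=\mathbb{R}$, has product $(z,u)\cdot(z',u')=(z\cdot e^{uD}z',u+u')$. $\breve X_1,\dots,\breve X_q$ are left-invariant vector fields on $N$ forming a basis of the first layer; $X_0|_{(z,u)}=\partial_u$, $X_j|_{(z,u)}=e^u\breve X_j|_z$ ($1\le j\le q$) are left-invariant vector fields on $G$. $\varrho^N$ (resp. $\varrho$) is the left-invariant Carnot--Carath\'eodory distance on $N$ (resp. $G$) associated with the sub-Riemannian metric making $\breve X_1,\dots,\breve X_q$ (resp. $X_0,\dots,X_q$) orthonormal: the distance between two points is the infimum of the lengths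 $\int(\sum_ja_j(t)^2)^{1/2}dt$ of the absolutely continuous curves joining them with tangent vector $\sum_ja_j(t)\breve X_j$ (resp. $\sum_ja_j(t)X_j$) for almost all $t$. *)

(* Defs.v *)
From mathcomp Require Import all_boot all_order all_algebra.
From mathcomp Require Import all_classical all_reals all_analysis.

Set Implicit Arguments.
Unset Strict Implicit.
Unset Printing Implicit Defensive.

Import Order.TTheory GRing.Theory Num.Theory.
Import numFieldNormedType.Exports.
Local Open Scope classical_set_scope.
Local Open Scope ring_scope.

Section Arccosh.
Context {R : realType}.

Definition cosh (x : R) : R := (expR x + expR (- x)) / 2.

Definition arccosh (y : R) : R := ln (y + Num.sqrt (y ^+ 2 - 1)).

Lemma arccosh_ge0 y : 1 <= y -> 0 <= arccosh y.
Proof. by move=> y1; rewrite ln_ge0// (le_trans y1)// lerDl sqrtr_ge0. Qed.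

Lemma arccoshK y : 1 <= y -> cosh (arccosh y) = y.
Proof.
move=> y1; rewrite /cosh /arccosh expRN; set s := Num.sqrt _.
have s0 : 0 <= s by exact: sqrtr_ge0.
have ys0 : 0 < y + s by rewrite ltr_pwDl// (lt_le_trans ltr01).
have s2 : s ^+ 2 = y ^+ 2 - 1 by rewrite sqr_sqrtr// subr_ge0 exprn_ege1.
rewrite lnK ?posrE//.
have -> : (y + s)^-1 = y - s.
  apply: (mulfI (lt0r_neq0 ys0)); rewrite mulfV ?lt0r_neq0//.
  by rewrite mulrC -subr_sqr s2 subKr.
by rewrite addrACA subrr addr0 mulrDl -splitr.
Qed.

(* Distances below are extended reals (an infimum over no curve is +oo), so
   arccosh : [1, +oo[ -> [0, +oo[ is extended by arccosh +oo = +oo; the value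
   at -oo is junk. *)
Definition arccoshe (y : \bar R) : \bar R :=
  match y with
  | r%:E => (arccosh r)%:E
  | +oo => +oo
  | -oo => 0
  end%E.

End Arccosh.

Section Smooth.
Context {R : realType}.

(* On finite-dimensional spaces (the only use below), f is of class C^k as
   soon as all its iterated directional derivatives of order at most k exist
   everywhere and are continuous. *)
Fixpoint Ck (U V : normedModType R) (k : nat) (f : U -> V) : Prop :=
  continuous f /\
  if k is k'.+1 then
    forall v, (forall x, derivable f x v) /\ Ck k' (fun x => 'D_v f x)
  else True.

Definition smooth (U V : normedModType R) (f : U -> V) := forall k, Ck k f.

End Smooth.

Section LieGroup.
Context {R : realType} {V : normedModType R}.
Implicit Types mul : V -> V -> V.

(* For a group law on V with neutral element 0, the value at z of the
   left-invariant vector field whose value at the neutral element is v. *)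
Definition left_inv mul (v z : V) : V := 'D_v (mul z) 0.

(* The value at 0 of the commutator of the left-invariant vector fields
   generated by x and y, i.e. the bracket of the Lie algebra of the group. *)
Definition lie_bracket mul (x y : V) : V :=
  'D_x (left_inv mul y) 0 - 'D_y (left_inv mul x) 0.

End LieGroup.

(* A stratified group is nilpotent and simply connected, so its exponential map
   is a diffeomorphism, through which the group is identified with its Lie
   algebra, here R^d after a choice of linear basis. That the resulting
   exponential map is the identity means that t |-> t x is the one-parameter
   subgroup generated by x; in particular the inverse of x is - x. *)
Record stratified_group (R : realType) (d : nat) := StratifiedGroup {
  smul : 'rV[R]_d -> 'rV[R]_d -> 'rV[R]_d ;
  smulA : associative smul ;
  smul0l : left_id 0 smul ;
  smul0r : right_id 0 smul ;
  smul_smooth : smooth (fun p : 'rV[R]_d * 'rV[R]_d => smul p.1 p.2) ;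
  smul_exp : forall (x : 'rV[R]_d) (s t : R),
    smul (s *: x) (t *: x) = (s + t) *: x ;
  (* the derivation D, acting on row vectors by x |-> x *m D *)
  sder : 'M[R]_d ;
  sder_derivation : forall x y : 'rV[R]_d,
    lie_bracket smul x y *m sder =
      lie_bracket smul (x *m sder) y + lie_bracket smul x (y *m sder) ;
  (* no proper Lie subalgebra contains the first layer *)
  sder_generates : forall W : 'M[R]_d, (eigenspace sder 1 <= W)%MS ->
    (forall x y : 'rV[R]_d, (x <= W)%MS -> (y <= W)%MS ->
       (lie_bracket smul x y <= W)%MS) ->
    row_full W
}.

Definition homogeneous_dim (R : realType) (d : nat) (N : stratified_group R d)
  : R := \tr (sder N).

Section CarnotCaratheodory.
Context {R : realType} {V : normedModType R} {n : nat}.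
Implicit Types (X : 'I_n -> V -> V) (f : R -> V) (c : 'I_n -> R -> R).

Definition abs_continuous (a b : R) f := forall e : R, 0 < e ->
  exists2 delta : R, 0 < delta & forall (m : nat) (s t : 'I_m -> R),
    (forall i, [/\ a <= s i, s i <= t i & t i <= b]) ->
    (forall i j, i != j -> t i <= s j \/ t j <= s i) ->
    \sum_i (t i - s i) < delta ->
    \sum_i `|f (t i) - f (s i)| < e.

(* The curve f on [a, b] has tangent vector \sum_i c_i X_i almost everywhere;
   what f and c do outside [a, b] is irrelevant. *)
Definition horizontal X (a b : R) f c : Prop :=
  [/\ abs_continuous a b f,
      forall i, measurable_fun `[a, b] (c i) &
      {ae (@lebesgue_measure R), forall t, a < t < b ->
        is_derive t 1 f (\sum_i c i t *: X i (f t))}].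

Definition cc_length (a b : R) c : \bar R :=
  (\int[@lebesgue_measure R]_(t in `[a, b])
     (Num.sqrt (\sum_i c i t ^+ 2))%:E)%E.

Definition cc_dist X (x y : V) : \bar R :=
  ereal_inf [set l | exists a b f c,
    [/\ a < b, f a = x, f b = y, horizontal X a b f c & l = cc_length a b c]].

End CarnotCaratheodory.

Section Frames.
Context {R : realType} {d q : nat}.
Variables (N : stratified_group R d) (E : 'M[R]_(q, d)).

(* e^{uD} z *)
Definition dilation (u : R) (z : 'rV[R]_d) : 'rV[R]_d :=
  limn (series (fun k : nat => (u ^+ k / k`!%:R) *: (z *m sder N ^+ k))).

Definition mulG (g g' : 'rV[R]_d * R) : 'rV[R]_d * R :=
  (smul N g.1 (dilation g.2 g'.1), g.2 + g'.2).

(* The rows of E are the values at 0 of the fields on N. *)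
Definition frameN (j : 'I_q) (z : 'rV[R]_d) : 'rV[R]_d :=
  left_inv (smul N) (row j E) z.

(* Index 0 is d/du, and index j.+1 is e^u times the j-th field on N. *)
Definition frameG (i : 'I_q.+1) (g : 'rV[R]_d * R) : 'rV[R]_d * R :=
  if unlift ord0 i is Some j then (expR g.2 *: frameN j g.1, 0) else (0, 1).

Definition distN : 'rV[R]_d -> 'rV[R]_d -> \bar R := cc_dist frameN.

Definition distG : 'rV[R]_d * R -> 'rV[R]_d * R -> \bar R := cc_dist frameG.

Lemma frameN0 j : frameN j 0 = row j E.
Proof.
rewrite /frameN /left_inv (_ : smul N 0 = id); last first.
  by apply/funext => x; rewrite smul0l.
by rewrite derive_id.
Qed.

Lemma dilation_eigen u z : z *m sder N = z -> dilation u z = expR u *: z.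
Proof.
move=> zD; rewrite /dilation.
have zDk k : z *m sder N ^+ k = z.
  by elim: k => [|k IH]; rewrite ?expr0 ?mulmx1// exprS mulmxA zD.
apply: cvg_lim => //.
rewrite (_ : series _ = (fun n => series (exp_coeff u) n *: z)); last first.
  apply/funext => n; rewrite /series/= scaler_suml; apply: eq_bigr => k _.
  by rewrite zDk /exp_coeff.
apply: cvgZr_tmp; rewrite /expR.
exact: is_cvg_series_exp_coeff.
Qed.

Lemma smul_derive_cvg z v :
  (fun h : R => h^-1 *: (smul N z (h *: v) - z)) @ 0^' --> left_inv (smul N) v z.
Proof.
have [_ /(_ (0, v))[/(_ (z, 0)) dF _]] := smul_smooth N 1.
have E1 : (fun h : R => h^-1 *: (((fun p => smul N p.1 p.2) \o
    shift (z, 0)) (h *: (0, v)) - smul N z 0)) =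
    (fun h : R => h^-1 *: (smul N z (h *: v) - z)).
  by apply/funext => h /=; rewrite scaler0 add0r addr0 smul0r.
have E2 : (fun h : R => h^-1 *: ((smul N z \o shift 0) (h *: v) - smul N z 0)) =
    (fun h : R => h^-1 *: (smul N z (h *: v) - z)).
  by apply/funext => h /=; rewrite addr0 smul0r.
rewrite /left_inv /derive E2 -E1; exact: dF.
Qed.

(* frameG consists of left-invariant vector fields on (G, mulG). *)
Lemma frameG_left_inv i g : (E <= eigenspace (sder N) 1)%MS ->
  frameG i g = left_inv mulG (frameG i 0) g.
Proof.
move=> EV; case: g => z u.
rewrite /frameG; case: unliftP => [j|] _ /=; rewrite [RHS]/left_inv /derive;
  apply/esym; apply: (cvg_lim (@norm_hausdorff R ('rV[R]_d * R)%type)).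
  rewrite expR0 scale1r frameN0 /frameN.
  set v := row j E; set k := expR u.
  have vD : v *m sder N = v.
    have /eigenspaceP : (v <= eigenspace (sder N) 1)%MS.
      by apply: submx_trans EV; exact: row_sub.
    by rewrite scale1r.
  have k0 : k != 0 by rewrite gt_eqF// expR_gt0.
  rewrite [X in X @ _](_ : _ = fun h : R =>
      (k *: ((h * k)^-1 *: (smul N z ((h * k) *: v) - z)), 0)); last first.
    apply/funext => h /=.
    rewrite /mulG /= !addr0 scaler0 !dilation_eigen ?mul0mx//; last first.
      by rewrite -scalemxAl vD.
    rewrite scaler0 smul0r addr0; apply/pair_equal_spec; split => /=; last first.
      by rewrite subrr scaler0.
    have -> : h^-1 = k * (h * k)^-1 by rewrite invfM mulrCA mulfV// mulr1.
    by rewrite -scalerA (scalerA (expR u)) -/k (mulrC k h) !scalerA.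
  have hk : h * k @[h --> 0^'] --> 0^'.
    move=> A A0; change (\forall h \near (0 : R), h != 0 -> A (h * k)).
    have kh : h * k @[h --> (0 : R)] --> (0 : R).
      rewrite -[X in _ --> X](mul0r k).
      by apply: cvgM; [exact: cvg_id | exact: cvg_cst].
    have B : \forall h \near (0 : R), h * k != 0 -> A (h * k) := kh _ A0.
    by apply: filterS B => h Ah h0; apply: Ah; rewrite mulf_neq0.
  have c1 : k *: ((h * k)^-1 *: (smul N z ((h * k) *: v) - z)) @[h --> 0^']
      --> k *: left_inv (smul N) v z.
    by apply: cvgZl_tmp; exact: (cvg_comp _ _ hk (@smul_derive_cvg z v)).
  have c2 : (fun=> 0 : R) @ (0 : R)^' --> (0 : R) by exact: cvg_cst.
  exact: (cvg_pair c1 c2).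
apply: cvg_near_cst.
near=> h => /=.
have h0 : h != 0 by near: h; exact: nbhs_dnbhs_neq.
rewrite /mulG /= !addr0 scaler0 !dilation_eigen ?mul0mx// scaler0 smul0r.
apply/pair_equal_spec; split => /=; first by rewrite subrr scaler0.
by rewrite [u + _]addrC addrK /GRing.scale/= mulr1 mulVf.
Unshelve. all: by end_near.
Qed.

End Frames.

(* Main.v *)
Require Import Defs.
From mathcomp Require Import all_boot all_order all_algebra.
From mathcomp Require Import all_classical all_reals all_analysis.
From mathcomp Require Import measurable_realfun ring lra.
Set Implicit Arguments.
Unset Strict Implicit.
Unset Printing Implicit Defensive.
Import Order.TTheory GRing.Theory Num.Theory.
Import numFieldNormedType.Exports.
Local Open Scope classical_set_scope.
Local Open Scope ring_scope.

(** The frame on [G] is the one of the warped product metric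
    [du^2 + e^(-2u) dz^2], and the formula is an instance of the one for the
    warped product with a line of any family of fields [X] on a normed space
    ([warped_cc_dist]). The length of a horizontal curve of the warped product
    depends only on the pair formed by the length covered by its projection
    and by the coordinate [u]. This pair is a path of the hyperbolic half-plane
    [du^2 + e^(-2u) dx^2], whence the hyperbolic distance between [(0, e^u0)]
    and [(l, e^u1)], with [l] the distance between the projections.

    Lower bound ([warped_length_ge], [half_plane_path_length]): the projection
    of a curve has some length [l'], at least [l], and the curve is at least as
    long as the geodesic of the half-plane from [(0, e^u0)] to [(l', e^u1)].
    The latter is shown with the Busemann function of an end of the geodesic:
    it is smooth, has gradient of norm one, and its increment between two
    points of the geodesic is their distance.

    Upper bound ([warped_lift]): a curve of length less than [l'] is lifted by
    taking for height the one that the geodesic from [(0, e^u0)] to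
    [(l', e^u1)] has above the length covered so far. The bound at [l] follows
    by letting [l'] decrease to [l].

    Curves are only absolutely continuous, with prescribed derivatives almost
    everywhere. Both bounds therefore rest on a comparison principle
    ([abs_continuous_increment_le]): if [g] is absolutely continuous, [Psi] is
    nondecreasing and [g' <= Psi'] almost everywhere, then the increment of [g]
    is at most that of [Psi]. *)

(** * Absolutely continuous functions *)

Section AbsContinuous.
Context {R : realType}.
Implicit Types (a b : R).
Notation mu := (@lebesgue_measure R).

(** The single closure property from which stability of absolute continuity
    under Lipschitz functions, sums, pairs and projections follows. *)
Lemma abs_continuous_dominated (U V W : normedModType R) a b K
    (f : R -> U) (g : R -> V) (h : R -> W) :
  abs_continuous a b f -> abs_continuous a b g ->
  (forall x y, a <= x -> x <= y -> y <= b ->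
    `|h y - h x| <= K * (`|f y - f x| + `|g y - g x|)) ->
  abs_continuous a b h.
Proof.
move=> acf acg hfg e e0.
pose K1 := `|K| + 1.
have K10 : 0 < K1 by rewrite ltr_wpDl.
have eK : 0 < e / (2 * K1) by rewrite divr_gt0// mulr_gt0.
have [df df0 Hf] := acf _ eK.
have [dg dg0 Hg] := acg _ eK.
exists (Num.min df dg); first by rewrite lt_min df0.
move=> m s t st disj; rewrite lt_min => /andP[sdf sdg].
have {}Hf := Hf _ _ _ st disj sdf.
have {}Hg := Hg _ _ _ st disj sdg.
apply: (@le_lt_trans _ _ (K1 *
    (\sum_i `|f (t i) - f (s i)| + \sum_i `|g (t i) - g (s i)|))).
  rewrite -big_split/= mulr_sumr; apply: ler_sum => i _.
  have [? ? ?] := st i.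
  apply: le_trans (hfg _ _ _ _ _) _ => //; apply: ler_wpM2r.
    by rewrite addr_ge0.
  by rewrite (le_trans (ler_norm _))// lerDl.
have -> : e = K1 * (e / (2 * K1) + e / (2 * K1)).
  by field; rewrite gt_eqF.
by rewrite ltr_pM2l// ltrD.
Qed.

Lemma abs_continuous_uniform (V : normedModType R) a b (f : R -> V) (e : R) :
  abs_continuous a b f -> 0 < e ->
  exists2 delta, 0 < delta & forall x y, a <= x <= b -> a <= y <= b ->
    `|y - x| < delta -> `|f y - f x| < e.
Proof.
move=> acf e0; have [dl dl0 H] := acf _ e0.
have main x y : a <= x -> x <= y -> y <= b -> y - x < dl -> `|f y - f x| < e.
  move=> ax xy yb xyd.
  have := H 1%N (fun=> x) (fun=> y); rewrite !big_ord1; apply => //.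
  by move=> i j; rewrite !ord1 eqxx.
exists dl => // x y /andP[ax xb] /andP[ay yb]; rewrite ltr_norml => /andP[d1 d2].
have [xy|/ltW yx] := leP x y; first exact: main.
by rewrite distrC; apply: main => //; rewrite ltrNl opprB in d1.
Qed.

Lemma abs_continuous_within a b (f : R -> R) : a < b ->
  abs_continuous a b f -> {within `[a, b], continuous f}.
Proof.
move=> ab acf; apply/continuous_within_itvP => //; split.
- move=> x; rewrite in_itv/= => /andP[ax xb].
  apply/cvgrPdist_lt => e e0.
  have [dl dl0 H] := abs_continuous_uniform acf e0.
  near=> y; apply: H; last by near: y; apply: cvgr_dist_lt.
  + by apply/andP; split; near: y; [exact: lt_le_nbhsr|exact: lt_le_nbhsl].
  + by rewrite !ltW.
- apply/cvgrPdist_lt => e e0.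
  have [dl dl0 H] := abs_continuous_uniform acf e0.
  near=> y; rewrite distrC; apply: H => //; first by rewrite lexx ltW.
  + by apply/andP; split; near: y; [exact: nbhs_right_ge|exact: nbhs_right_ltW].
  + rewrite gtr0_norm ?subr_gt0// ltrBlDl; near: y.
    by apply: nbhs_right_lt; rewrite ltrDl.
- apply/cvgrPdist_lt => e e0.
  have [dl dl0 H] := abs_continuous_uniform acf e0.
  near=> y; apply: H => //; last 2 first.
  + by rewrite lexx ltW.
  + rewrite gtr0_norm ?subr_gt0// ltrBlDl -ltrBlDr; near: y.
    by apply: nbhs_left_gt; rewrite gtrBl.
  + by apply/andP; split; near: y; [exact: nbhs_left_ge|exact: nbhs_left_le].
Unshelve. all: by end_near. Qed.

Lemma trivIset_disjoint_itv m (s t : 'I_m -> R) :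
  (forall i j, i != j -> t i <= s j \/ t j <= s i) ->
  trivIset setT (fun i => `]s i, t i]%classic).
Proof.
move=> disj; apply/trivIsetP => i j _ _ /disj [ts|ts];
  rewrite -subset0 => x /=; rewrite !in_itv/= => -[/andP[a1 a2] /andP[a3 a4]].
- by have := le_lt_trans (le_trans a2 ts) a3; rewrite ltxx.
- by have := le_lt_trans (le_trans a4 ts) a1; rewrite ltxx.
Qed.

Lemma measure_disjoint_itv m (s t : 'I_m -> R) :
  (forall i, s i <= t i) ->
  (forall i j, i != j -> t i <= s j \/ t j <= s i) ->
  mu (\big[setU/set0]_(i < m) `]s i, t i]%classic) = (\sum_i (t i - s i))%:E.
Proof.
move=> st disj.
rewrite measure_semi_additive_ord//=; last 2 first.
- exact: trivIset_disjoint_itv.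
- by apply: bigsetU_measurable => i _; exact: measurable_itv.
rewrite -sumEFin; apply: eq_bigr => i _.
rewrite lebesgue_measure_itv/= lte_fin.
have := st i; rewrite le_eqVlt => /predU1P[->|stI].
  by rewrite ltxx subrr.
by rewrite stI EFinB.
Qed.

End AbsContinuous.

Section AbsContinuousClosure.
Context {R : realType}.
Variables (a b : R).

Lemma abs_continuous_lipschitz (U V : normedModType R) K (f : R -> U) (h : R -> V) :
  abs_continuous a b f ->
  (forall x y, a <= x -> x <= y -> y <= b ->
    `|h y - h x| <= K * `|f y - f x|) ->
  abs_continuous a b h.
Proof.
move=> acf hf.
apply: (abs_continuous_dominated (K := K / 2) acf acf) => x y ax xy yb.
by rewrite (_ : _ / 2 * _ = K * `|f y - f x|) ?hf//; field.
Qed.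

Lemma abs_continuous_add (U : normedModType R) (f g : R -> U) :
  abs_continuous a b f -> abs_continuous a b g -> abs_continuous a b (f \+ g).
Proof.
move=> acf acg; apply: (abs_continuous_dominated (K := 1) acf acg) => x y _ _ _ /=.
by rewrite mul1r opprD addrACA ler_normD.
Qed.

Lemma abs_continuous_bounded (f : R -> R) : a < b -> abs_continuous a b f ->
  exists M, forall t, a <= t <= b -> `|f t| <= M.
Proof.
move=> ab acf; have cf := abs_continuous_within ab acf.
have [c _ fc] := EVT_max (ltW ab) cf; have [d _ fd] := EVT_min (ltW ab) cf.
exists (`|f c| + `|f d|) => t tab; rewrite ler_norml.
have /fc f1 : t \in `[a, b] by [].
have /fd f2 : t \in `[a, b] by [].
have := ler_norm (f c); have := ler_norm (- f d); rewrite normrN.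
have := normr_ge0 (f c); have := normr_ge0 (f d).
by move=> *; apply/andP; split; lra.
Qed.

Lemma abs_continuous_ln (m : R) (f : R -> R) : 0 < m ->
  (forall t, a <= t <= b -> m <= f t) ->
  abs_continuous a b f -> abs_continuous a b (fun t => ln (f t)).
Proof.
move=> m0 mf acf; apply: (abs_continuous_lipschitz (K := m^-1) acf) => x y ax xy yb.
have mx : m <= f x by rewrite mf// ax (le_trans xy).
have my : m <= f y by rewrite mf// yb (le_trans ax).
have main z z' : m <= z -> m <= z' -> ln z - ln z' <= m^-1 * `|z - z'|.
  move=> mz mz'; have z0 : 0 < z by exact: lt_le_trans mz.
  have z'0 : 0 < z' by exact: lt_le_trans mz'.
  rewrite -ln_div ?posrE//; have -> : z / z' = 1 + (z - z') / z'.
    by field; rewrite gt_eqF.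
  apply: le_trans (le_ln1Dx _) _.
    by rewrite mulrBl divff ?gt_eqF// ltrBrDr addNr divr_gt0.
  apply: le_trans (ler_norm _) _.
  by rewrite normrM normfV (gtr0_norm z'0) mulrC ler_wpM2r// lef_pV2 ?posrE.
by rewrite ler_norml lerNl opprB main// andbT distrC main.
Qed.

Lemma abs_continuous_expR (M : R) (f : R -> R) :
  (forall t, a <= t <= b -> f t <= M) ->
  abs_continuous a b f -> abs_continuous a b (fun t => expR (f t)).
Proof.
move=> fM acf; apply: (abs_continuous_lipschitz (K := expR M) acf) => x y ax xy yb.
have mx : f x <= M by rewrite fM// ax (le_trans xy).
have my : f y <= M by rewrite fM// yb (le_trans ax).
have main z z' : z <= M -> expR z - expR z' <= expR M * `|z - z'|.
  move=> zM; have -> : expR z' = expR z * expR (z' - z).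
    by rewrite -expRD addrC subrK.
  rewrite -[X in X - _]mulr1 -mulrBr.
  apply: (@le_trans _ _ (expR z * `|z - z'|)); last by rewrite ler_wpM2r// ler_expR.
  rewrite ler_wpM2l ?expR_ge0//; apply: le_trans (ler_norm (z - z')).
  by have := expR_ge1Dx (z' - z); lra.
by rewrite ler_norml lerNl opprB main// andbT distrC main.
Qed.

Lemma abs_continuous_sqr (f : R -> R) : a < b ->
  abs_continuous a b f -> abs_continuous a b (fun t => f t ^+ 2).
Proof.
move=> ab acf; have [M fM] := abs_continuous_bounded ab acf.
apply: (abs_continuous_lipschitz (K := M + M) acf) => x y ax xy yb.
have mx : `|f x| <= M by rewrite fM// ax (le_trans xy).
have my : `|f y| <= M by rewrite fM// yb (le_trans ax).
rewrite subr_sqr normrM mulrC ler_wpM2r// (le_trans (ler_normD _ _))//.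
exact: lerD.
Qed.

End AbsContinuousClosure.

(** * Comparison of increments by derivatives almost everywhere *)

Section VariationInside.
Context {R : realType} (U : set R) (a : R) (g : R -> R).

(** Only the intervals contained in [U] contribute, so that absolute
    continuity makes these sums small when [U] has small measure. *)
Definition variation_sums (t : R) : set R :=
  [set x | exists m (s s' : 'I_m -> R),
  [/\ forall i, [/\ a <= s i, s i <= s' i & s' i <= t],
      forall i, `[s i, s' i]%classic `<=` U,
      forall i j, i != j -> s' i <= s j \/ s' j <= s i &
      x = \sum_i `|g (s' i) - g (s i)|]].

Definition variation_in (t : R) : R := sup (variation_sums t).

Lemma variation_sums0 t : variation_sums t 0.
Proof.
exists 0%N, (fun=> 0), (fun=> 0); split => [[]//|[]//|[]//|].
by rewrite big_ord0.
Qed.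

Lemma variation_sums_cat x y v : a <= x -> x <= y -> `[x, y]%classic `<=` U ->
  variation_sums x v -> variation_sums y (`|g y - g x| + v).
Proof.
move=> ax xy xyU [m [s [s' [st sU disj ->]]]].
exists m.+1, (fun i => oapp s x (unlift ord0 i)),
  (fun i => oapp s' y (unlift ord0 i)).
split.
- move=> i; case: unliftP => [j|] _ /=; last by split.
  by have [? ? s'x] := st j; split => //; exact: le_trans s'x xy.
- by move=> i; case: unliftP => [j|] _ /=; [exact: sU|].
- move=> i j; case: unliftP => [i'|] ->; case: unliftP => [j'|] -> /= ij.
  + by apply: disj; apply: contra_neq ij => ->.
  + by left; have [] := st i'.
  + by right; have [] := st j'.
  + by move/negP: ij; case.
- rewrite big_ord_recl unlift_none/=; congr (_ + _).
  by apply: eq_bigr => i _; rewrite liftK.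
Qed.

Lemma variation_sums_le x y : x <= y -> variation_sums x `<=` variation_sums y.
Proof.
move=> xy v [m [s [s' [st sU disj ->]]]]; exists m, s, s'; split => // i.
by have [? ? s'x] := st i; split => //; exact: le_trans s'x xy.
Qed.

Variables (b e : R).
Hypothesis sums_le : forall v, variation_sums b v -> v <= e.

Lemma variation_in_has_sup t : t <= b -> has_sup (variation_sums t).
Proof.
move=> tb; split; first by exists 0; exact: variation_sums0.
by exists e => v /(variation_sums_le tb); exact: sums_le.
Qed.

Lemma variation_in_bound t : t <= b -> 0 <= variation_in t <= e.
Proof.
move=> tb; have hs := variation_in_has_sup tb; apply/andP; split.
  by apply: sup_upper_bound => //; exact: variation_sums0.
by apply: ge_sup; [exact: hs.1|move=> v /(variation_sums_le tb); exact: sums_le].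
Qed.

Lemma variation_in_le x y : x <= y -> y <= b -> variation_in x <= variation_in y.
Proof.
move=> xy yb; apply: ge_sup; first by exists 0; exact: variation_sums0.
move=> v /(variation_sums_le xy); apply: sup_upper_bound.
exact: variation_in_has_sup.
Qed.

(** An interval inside [U] can be appended to any family to its left: the
    increase of [g] on it is absorbed by that of the variation. *)
Lemma variation_in_increment x y : a <= x -> x <= y -> y <= b ->
  `[x, y]%classic `<=` U -> g y - g x <= variation_in y - variation_in x.
Proof.
move=> ax xy yb xyU; rewrite lerBrDl -lerBrDr.
apply: ge_sup; first by exists 0; exact: variation_sums0.
move=> v xv; rewrite lerBrDr addrC.
apply: (@le_trans _ _ (`|g y - g x| + v)); first by rewrite lerD2r ler_norm.
apply: sup_upper_bound; first exact: variation_in_has_sup.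
exact: variation_sums_cat xv.
Qed.

End VariationInside.

Section Increment.
Context {R : realType}.
Notation mu := (@lebesgue_measure R).

Lemma null_set_open_cover (A : set R) (e : R) :
  measurable A -> mu A = 0%E -> 0 < e ->
  exists2 U : set R, open U /\ A `<=` U & (mu U < e%:E)%E.
Proof.
move=> mA A0 e0.
have Aoo : (mu A < +oo)%E by rewrite A0.
have [U [oU AU UA]] := @lebesgue_regularity_outer R A e mA Aoo e0.
have mUA : measurable (U `\` A).
  by apply: measurableD => //; exact: open_measurable.
exists U => //; apply: le_lt_trans UA.
have {1}-> : U = A `|` (U `\` A) by rewrite setDUK.
have : (mu (A `|` (U `\` A)) <= mu A + mu (U `\` A))%E by exact: measureU2.
by rewrite A0 add0e.
Qed.

(** The points without good derivatives form a null set, which has an open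
    neighbourhood [U] so small that the variation [V] of [g] inside [U] is at
    most [e]. From every point before [b] one can move to the right without
    increasing [g t - Psi t - V t - e * (t - a)]: on [U] because [V] absorbs
    the growth of [g], outside because of the inequality between derivatives.
    Hence this expression is still at most [g a - Psi a] at [b], which is the
    claim up to an error proportional to [e]. *)
Lemma abs_continuous_increment_le a b (g Psi : R -> R) : a <= b ->
  abs_continuous a b g ->
  {in `[a, b] &, {homo Psi : x y / x <= y}} ->
  {ae mu, forall t, a < t < b -> exists g' Psi',
    [/\ is_derive t 1 g g', is_derive t 1 Psi Psi' & g' <= Psi']} ->
  g b - g a <= Psi b - Psi a.
Proof.
move=> ab acg Psi_le [A [mA A0 dA]].
apply/ler_addgt0Pr => e0 e00.
(* the total error is V b + e * (b - a), at most e * (1 + (b - a)) *)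
pose e := e0 / (1 + (b - a)).
have c0 : 0 < 1 + (b - a) by rewrite ltr_pwDl// subr_ge0.
have e_gt0 : 0 < e by rewrite divr_gt0.
have [dl dl0 Hdl] := acg _ e_gt0.
(* nothing is known about derivatives at a: this point joins the bad set *)
have [|||U [oU AU] Udl] := @null_set_open_cover (A `|` [set a]) dl.
- by apply: measurableU => //; exact: measurable_set1.
- apply/eqP; rewrite eq_le measure_ge0 andbT.
  have : (mu (A `|` [set a]) <= mu A + mu [set a])%E.
    by apply: measureU2 => //; exact: measurable_set1.
  have {}A0 : mu A = 0%E by exact: A0.
  by rewrite A0 add0e lebesgue_measure_set1.
- exact: dl0.
have sumsU v : variation_sums U a g b v -> v <= e.
  move=> [m [s [s' [st sU disj ->]]]]; apply/ltW/Hdl => //.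
  rewrite -lte_fin -(measure_disjoint_itv _ disj); last by move=> i; have [] := st i.
  apply: le_lt_trans Udl; apply: le_measure; rewrite ?inE.
  + by apply: bigsetU_measurable => i _; exact: measurable_itv.
  + exact: open_measurable.
  + apply: (big_ind (fun B : set R => B `<=` U)) => //.
      by move=> B C BU CU x [/BU|/CU].
    move=> i _; apply: subset_trans (sU i); apply: subset_itvr.
    by rewrite bnd_simp.
pose V := variation_in U a g.
pose S := [set t | a <= t <= b /\ g t <= g a + (Psi t - Psi a) + V t + e * (t - a)].
have Va : 0 <= V a by have /andP[] := variation_in_bound sumsU ab.
have Sa : S a by split; rewrite ?lexx//= !subrr mulr0 !addr0 lerDl.
have hS : has_sup S by split; [exists a|exists b => t [/andP[]]].
set c := sup S.
have ac : a <= c by apply: sup_upper_bound.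
have cb : c <= b by apply: ge_sup; [exact: hS.1|move=> t [/andP[]]].
(* the supremum is approached from the left, so that Psi and V, which may
   jump, are controlled by their monotonicity *)
have Sc : S c.
  split; first by rewrite ac.
  apply/ler_addgt0Pr => h h0.
  have [d d0 Hd] := abs_continuous_uniform acg h0.
  have [t [/andP[at_ tb] St] ct] := sup_adherent d0 hS.
  have tc : t <= c by apply: sup_upper_bound => //; split => //; rewrite at_.
  have /ltW : `|g c - g t| < h.
    apply: Hd; rewrite ?at_ ?ac// ger0_norm ?subr_ge0//.
    by rewrite ltrBlDr addrC -ltrBlDr.
  move=> /(le_trans (ler_norm _)).
  have P1 : Psi t <= Psi c by apply: Psi_le; rewrite // in_itv/= ?at_ ?ac.
  have P2 : V t <= V c by exact: (variation_in_le sumsU).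
  have P3 : e * (t - a) <= e * (c - a) by rewrite ler_pM2l// lerB.
  lra.
have [cltb|bc] := ltP c b; last first.
  have <- : c = b by apply/eqP; rewrite eq_le cb.
  have [_] := Sc; have /andP[_] := variation_in_bound sumsU cb; rewrite -/(V c).
  have P3 : e * (c - a) <= e * (b - a) by rewrite ler_pM2l// lerB.
  have : e0 = e + e * (b - a) by rewrite /e; field; rewrite gt_eqF.
  by lra.
exfalso.
suff [t' [ct' t'b St']] : exists t', [/\ c < t', t' <= b &
    g t' - g c <= Psi t' - Psi c + (V t' - V c) + e * (t' - c)].
  have : S t'.
    split; first by rewrite (le_trans ac (ltW ct')).
    by have [_] := Sc; lra.
  by move=> /(sup_upper_bound hS); rewrite leNgt ct'.
have [Uc|nUc] := pselect (U c).
  have /nbhs_ballP[r /= r0 cr] := open_nbhs_nbhs (conj oU Uc).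
  exists (Num.min b (c + r / 2)); rewrite ge_min lexx lt_min cltb ltrDl divr_gt0//.
  set t' := Num.min _ _.
  have ct' : c <= t' by rewrite le_min cb lerDl ltW// divr_gt0.
  have t'b : t' <= b by rewrite ge_min lexx.
  have t'r : t' <= c + r / 2 by rewrite ge_min lexx orbT.
  split => //.
  have P1 : Psi c <= Psi t'.
    by apply: Psi_le; rewrite // in_itv/= ?ac ?t'b ?(le_trans ac).
  have P2 : g t' - g c <= V t' - V c.
    apply: (variation_in_increment sumsU) => // x /=.
    rewrite in_itv/= => /andP[cx xt'].
    apply: cr; rewrite /ball/= ltr_distlC; apply/andP; split; first by lra.
    by lra.
  have P3 : 0 <= e * (t' - c) by rewrite mulr_ge0// ?subr_ge0// ltW.
  lra.
have altc : a < c.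
  by rewrite lt_neqAle ac andbT; apply/eqP => aE; apply: nUc; apply: AU; right.
have : exists g' Psi', [/\ is_derive c 1 g g', is_derive c 1 Psi Psi' & g' <= Psi'].
  apply: contrapT => nd; apply: nUc; apply: AU; left; apply: dA => /= H; apply: nd.
  by apply: H; rewrite altc.
move=> [g' [Psi' [dg dPsi gP]]].
have dgP : is_derive c 1 (g - Psi) (g' - Psi') by exact: is_deriveB.
have [dgP1 dgP2] := dgP.
move/cvg_ex : dgP1 => [l dgPl].
have lE : l = g' - Psi' by rewrite -dgP2; apply/esym/cvg_lim.
have l0 : l < e by rewrite lE; lra.
near (0 : R)^'+ => h.
have h0 : 0 < h by [].
have hb : c + h <= b.
  by rewrite -lerBrDl; near: h; apply: nbhs_right_le; rewrite subr_gt0.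
exists (c + h); split; rewrite ?ltrDl//.
have P2 : V c <= V (c + h).
  by apply: (variation_in_le sumsU) => //; rewrite lerDl ltW.
suff : (g - Psi) (c + h) - (g - Psi) c <= e * h.
  by rewrite !fctE; lra.
rewrite -ler_pdivrMr// mulrC.
have : h^-1 *: ((g - Psi) (h *: 1 + c) - (g - Psi) c) <= e.
  by near: h; apply: (cvgr_le _ (cvg_dnbhs_at_right dgPl)).
by rewrite [h *: _]mulr1 (addrC h c).
Unshelve. all: by end_near. Qed.

End Increment.

(** * Primitives of nonnegative integrable functions *)

Section Primitive.
Context {R : realType}.
Notation mu := (@lebesgue_measure R).
Variables (a : R) (phi : R -> R).
Hypothesis phi_ge0 : forall t, 0 <= phi t.
Hypothesis phi_int : mu.-integrable [set: R] (EFin \o phi).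

Definition primitive (t : R) : R := (\int[mu]_(s in `]a, t]) phi s)%R.

Let phi_itg (i : interval R) : mu.-integrable [set` i] (EFin \o phi).
Proof. by apply: integrableS phi_int. Qed.

Lemma primitive_refl : primitive a = 0.
Proof. by rewrite /primitive set_itv_ge ?Rintegral_set0// bnd_simp ltxx. Qed.

Lemma primitiveB x y : a <= x -> x <= y ->
  primitive y - primitive x = (\int[mu]_(s in `]x, y]) phi s)%R.
Proof.
move=> ax xy; rewrite /primitive (@itv_bndbnd_setU _ _ _ (BRight x))//=.
rewrite Rintegral_setU//=.
- by rewrite addrAC subrr add0r.
- by rewrite -itv_bndbnd_setU//=; exact: phi_itg.
- apply/disj_setPS => z/= []; rewrite !in_itv/= => /andP[_ zx] /andP[xz _].
  by have := lt_le_trans xz zx; rewrite ltxx.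
Qed.

Lemma primitive_le x y : x <= y -> primitive x <= primitive y.
Proof.
move=> xy; have [xa|ax] := ltP x a.
  rewrite [leLHS](_ : _ = 0); first by apply: Rintegral_ge0.
  by rewrite /primitive set_itv_ge ?Rintegral_set0// bnd_simp -leNgt ltW.
by rewrite -subr_ge0 primitiveB//; apply: Rintegral_ge0.
Qed.

Lemma primitive_ae_is_derive :
  {ae mu, forall t, a < t -> is_derive t 1 primitive (phi t)}.
Proof.
have loc : locally_integrable setT phi.
  by apply: open_integrable_locally => //; exact: openT.
have := @FTC1 R phi (BRight a) (fun y => phi_itg _) loc.
apply: filterS; first exact: (ae_filter_ringOfSetsType mu).
move=> t /= H at_; have [d1 d2] := H at_.
split; first exact: d1.
by rewrite -derive1E; exact: d2.
Qed.

Lemma primitive_abs_continuous c : abs_continuous a c primitive.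
Proof.
move=> e e0; have [d [d0 Hd]] := integral_normr_continuous phi_int e0.
exists d => // m s t st disj sd.
pose A := \big[setU/set0]_(i < m) `]s i, t i]%classic.
have mA : measurable A by apply: bigsetU_measurable => i _; exact: measurable_itv.
have Ad : (mu A < d%:E)%E.
  by rewrite (measure_disjoint_itv _ disj)// => i; have [] := st i.
apply: le_lt_trans (Hd A mA Ad).
rewrite le_eqVlt; apply/orP; left; apply/eqP.
have mphi (B : set R) : measurable B -> measurable_fun B phi.
  move=> mB; apply/measurable_EFinP.
  by apply: measurable_funS (measurable_int _ phi_int).
have phi_fin x y : (\int[mu]_(z in `]x, y]) (phi z)%:E)%E \is a fin_num.
  by apply: integrable_fin_num => //; exact: (phi_itg `]x, y]).
rewrite /Rintegral /A ge0_integral_bigsetU//=; last 3 first.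
- exact: index_enum_uniq.
- by apply: sub_trivIset (trivIset_disjoint_itv disj).
- by apply/measurable_EFinP/measurableT_comp => //; exact: mphi.
rewrite -sum_fine => [|i _]; last by under eq_integral do rewrite ger0_norm//.
apply: eq_bigr => i _; have [ai si _] := st i.
rewrite ger0_norm ?subr_ge0; last exact: primitive_le.
rewrite primitiveB// /Rintegral; congr fine.
by apply: eq_integral => x _; rewrite ger0_norm.
Qed.

End Primitive.

(** * Distance in the hyperbolic half-plane *)

Section HyperbolicCosine.
Context {R : realType}.
Implicit Types t u l x y : R.

Lemma arccosh_cosh t : arccosh (cosh t) = `|t|.
Proof.
have main s : 0 <= s -> arccosh (cosh s) = s.
  move=> s0; rewrite /arccosh /cosh expRN; set e := expR s.
  have e1 : 1 <= e by rewrite /e -expR0 ler_expR.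
  have e0 : 0 < e by exact: expR_gt0.
  have -> : ((e + e^-1) / 2) ^+ 2 - 1 = ((e - e^-1) / 2) ^+ 2.
    by field; rewrite gt_eqF.
  have e1e : e^-1 <= e by rewrite (le_trans _ e1)// invf_le1.
  rewrite sqrtr_sqr ger0_norm ?divr_ge0 ?subr_ge0//.
  by rewrite (_ : _ + _ = e) ?expRK//; field; rewrite gt_eqF.
have [t0|t0] := leP 0 t; first by rewrite main// ger0_norm.
rewrite ltr0_norm// -[RHS]main ?oppr_ge0 ?ltW//.
by rewrite /cosh opprK addrC.
Qed.

Lemma cosh_ge1 t : 1 <= cosh t.
Proof.
rewrite /cosh expRN; have e0 := expR_gt0 t; set e := expR t in e0 *.
rewrite ler_pdivlMr// mul1r -subr_ge0.
have -> : e + e^-1 - 2 = (e - 1) ^+ 2 / e by field; rewrite gt_eqF.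
by rewrite divr_ge0 ?sqr_ge0 ?ltW.
Qed.

Lemma arccosh_le x y : 1 <= x -> x <= y -> arccosh x <= arccosh y.
Proof.
move=> x1 xy; rewrite /arccosh ler_ln ?posrE.
- apply: lerD => //; rewrite ler_wsqrtr// lerD2r lerXn2r ?nnegrE//.
    by rewrite (le_trans _ x1).
  by rewrite (le_trans _ (le_trans x1 xy)).
- by rewrite ltr_pwDl ?sqrtr_ge0// (lt_le_trans _ x1).
- by rewrite ltr_pwDl ?sqrtr_ge0// (lt_le_trans _ (le_trans x1 xy)).
Qed.

Lemma arccosh_continuous y : 1 <= y -> {for y, continuous (@arccosh R)}.
Proof.
move=> y1; rewrite /arccosh.
apply: continuous_comp; last first.
  by apply: continuous_ln; rewrite ltr_pwDl ?sqrtr_ge0// (lt_le_trans _ y1).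
apply: continuousD; first exact: cvg_id.
apply: continuous_comp; last exact: sqrt_continuous.
by apply: continuousB; [exact: exprn_continuous|exact: cvg_cst].
Qed.

(** The hyperbolic cosine of the distance from [(0, e^u0)] to [(l, e^u1)] in
    the upper half-plane with metric [(dx^2 + dy^2) / y^2]; with [y = e^u] the
    metric is [du^2 + e^(-2u) dx^2]. *)
Definition half_plane_cosh u0 u1 l : R :=
  cosh (u0 - u1) + expR (- (u0 + u1)) * l ^+ 2 / 2.

Lemma half_plane_cosh_ge1 u0 u1 l : 1 <= half_plane_cosh u0 u1 l.
Proof.
rewrite (le_trans (cosh_ge1 (u0 - u1)))// lerDl.
by rewrite divr_ge0// mulr_ge0 ?expR_ge0 ?sqr_ge0.
Qed.

Lemma half_plane_cosh_le u0 u1 l l' : 0 <= l -> l <= l' ->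
  half_plane_cosh u0 u1 l <= half_plane_cosh u0 u1 l'.
Proof.
move=> l0 ll'; rewrite lerD2l ler_pM2r ?invr_gt0// ler_pM2l ?expR_gt0//.
by rewrite lerXn2r ?nnegrE// (le_trans l0).
Qed.

(** The geodesic between two points that are not on a vertical line is an arc
    of a circle centred on the boundary, which it meets at [- p] and [l + w].
    At abscissa [s] the product of the distances [p + s] and [l + w - s] to
    these two ends is the square of the height, and half the logarithm of
    their quotient is an arc length parameter. *)
Lemma half_plane_circle u0 u1 l : 0 < l -> exists p w : R,
  [/\ 0 < p, 0 < w,
      u0 = (ln p + ln (l + w)) / 2,
      u1 = (ln (p + l) + ln w) / 2 &
      arccosh (half_plane_cosh u0 u1 l) =
        (ln (p + l) - ln w) / 2 - (ln p - ln (l + w)) / 2].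
Proof.
move=> l0.
(* x0 is the centre of the circle and r its radius *)
pose x0 := (l ^+ 2 + expR u1 ^+ 2 - expR u0 ^+ 2) / (2 * l).
pose r := Num.sqrt (x0 ^+ 2 + expR u0 ^+ 2).
have r2 : r ^+ 2 = x0 ^+ 2 + expR u0 ^+ 2 by rewrite sqr_sqrtr// addr_ge0 ?sqr_ge0.
have r2' : r ^+ 2 = (x0 - l) ^+ 2 + expR u1 ^+ 2.
  by rewrite r2 /x0; field; rewrite gt_eqF.
have r0 : 0 <= r by exact: sqrtr_ge0.
have lt_norm (z e : R) : r ^+ 2 = z ^+ 2 + expR e ^+ 2 -> `|z| < r.
  move=> rz; rewrite -(@ltr_pXn2r _ 2)// ?nnegrE// rz real_normK ?num_real// ltrDl.
  by rewrite exprn_gt0 ?expR_gt0.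
have := lt_norm _ _ r2; rewrite ltr_norml => /andP[xr1 xr2].
have := lt_norm _ _ r2'; rewrite ltr_norml => /andP[xr3 xr4].
pose p := r - x0; pose w := r + x0 - l.
have p0 : 0 < p by rewrite subr_gt0.
have w0 : 0 < w by rewrite /w; lra.
have lw0 : 0 < l + w by rewrite addr_gt0.
have pl0 : 0 < p + l by rewrite addr_gt0.
have u0E : u0 = (ln p + ln (l + w)) / 2.
  rewrite -lnM ?posrE// (_ : p * _ = expR u0 ^+ 2); last first.
    rewrite (_ : _ * _ = r ^+ 2 - x0 ^+ 2); first by rewrite r2; ring.
    by rewrite /p /w; ring.
  by rewrite lnXn ?expR_gt0// expRK mulr2n; lra.
have u1E : u1 = (ln (p + l) + ln w) / 2.
  rewrite -lnM ?posrE// (_ : (p + l) * _ = expR u1 ^+ 2); last first.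
    rewrite (_ : _ * _ = r ^+ 2 - (x0 - l) ^+ 2); first by rewrite r2'; ring.
    by rewrite /p /w; ring.
  by rewrite lnXn ?expR_gt0// expRK mulr2n; lra.
exists p, w; split => //.
(* square roots of the distances to the ends of the circle, from the abscissa 0
   for al and be, from l for ga and ze *)
pose al := expR (ln p / 2); pose be := expR (ln (l + w) / 2).
pose ga := expR (ln (p + l) / 2); pose ze := expR (ln w / 2).
have sq z : 0 < z -> expR (ln z / 2) ^+ 2 = z.
  by move=> z0; rewrite expr2 -expRD -splitr lnK.
have al2 : al ^+ 2 = p by exact: sq.
have be2 : be ^+ 2 = l + w by exact: sq.
have ga2 : ga ^+ 2 = p + l by exact: sq.
have ze2 : ze ^+ 2 = w by exact: sq.
rewrite (_ : half_plane_cosh u0 u1 l =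
    cosh ((ln (p + l) - ln w) / 2 - (ln p - ln (l + w)) / 2)).
  rewrite arccosh_cosh ger0_norm//.
  have : ln p <= ln (p + l) by rewrite ler_ln ?posrE// lerDl ltW.
  have : ln w <= ln (l + w) by rewrite ler_ln ?posrE// lerDr ltW.
  lra.
rewrite /half_plane_cosh /cosh.
have -> : u0 - u1 = ln p / 2 + ln (l + w) / 2 - (ln (p + l) / 2 + ln w / 2).
  by rewrite [in LHS]u0E [in LHS]u1E; ring.
have -> : u0 + u1 = ln p / 2 + ln (l + w) / 2 + (ln (p + l) / 2 + ln w / 2).
  by rewrite [in LHS]u0E [in LHS]u1E; ring.
have -> : (ln (p + l) - ln w) / 2 - (ln p - ln (l + w)) / 2 =
    ln (p + l) / 2 + ln (l + w) / 2 - (ln p / 2 + ln w / 2) by ring.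
rewrite !expRN !expRD !expRN !expRD -/al -/be -/ga -/ze.
have lE : l ^+ 2 = ga ^+ 2 * be ^+ 2 + al ^+ 2 * ze ^+ 2
    - al ^+ 2 * be ^+ 2 - ga ^+ 2 * ze ^+ 2.
  by rewrite al2 be2 ga2 ze2; ring.
rewrite lE; field.
by rewrite /al /be /ga /ze !gt_eqF ?expR_gt0.
Qed.

Lemma arccosh_half_plane_cosh_continuous (u0 u1 r : R) :
  {for r, continuous (fun l => arccosh (half_plane_cosh u0 u1 l))}.
Proof.
apply: (@continuous_comp _ _ _ (half_plane_cosh u0 u1)); last first.
  exact/arccosh_continuous/half_plane_cosh_ge1.
apply: continuousD; first exact: cst_continuous.
apply: continuousM; last exact: cst_continuous.
by apply: continuousM; [exact: cst_continuous|exact: exprn_continuous].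
Qed.

Lemma half_plane_cosh_quotient u0 u1 l :
  half_plane_cosh u0 u1 l =
  (1 + expR (2 * (u1 - u0)) + (expR (- u0) * l) ^+ 2) / (2 * expR (u1 - u0)).
Proof.
rewrite /half_plane_cosh /cosh -[u0 - u1]opprB opprK.
have -> : 2 * (u1 - u0) = (u1 - u0) + (u1 - u0) by ring.
have -> : - (u0 + u1) = - u0 + - u0 + - (u1 - u0) by ring.
rewrite !(expRD (u1 - u0)) !(expRD _ (- (u1 - u0))) (expRD (- u0)) (expRN (u1 - u0)).
by field; rewrite !gt_eqF ?expR_gt0.
Qed.

End HyperbolicCosine.

Section HalfPlanePath.
Context {R : realType}.
Notation mu := (@lebesgue_measure R).

Lemma cauchy_schwarz2 (al be c x y : R) : 0 <= c -> al ^+ 2 + be ^+ 2 = c ^+ 2 ->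
  al * x + be * y <= c * Num.sqrt (x ^+ 2 + y ^+ 2).
Proof.
move=> c0 abc; apply: le_trans (ler_norm _) _.
rewrite -[in leRHS](ger0_norm c0) -!sqrtr_sqr -sqrtrM ?sqr_ge0// ler_wsqrtr//.
rewrite -abc -subr_ge0 (_ : _ - _ = (al * y - be * x) ^+ 2) ?sqr_ge0//.
by ring.
Qed.

(** Derivative along a path of the Busemann function of the boundary point
    [- p], which is [ln (((x + p)^2 + y^2) / y)] with [y = e^u]. *)
Lemma is_derive_busemann (sigma u : R -> R) (t p v w : R) : 0 < sigma t + p ->
  is_derive t 1 sigma v -> is_derive t 1 u w ->
  is_derive t 1 (fun s => ln ((sigma s + p) ^+ 2 + expR (u s) ^+ 2) - u s)
    ((2 * (sigma t + p) * v + 2 * expR (u t) ^+ 2 * w) /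
       ((sigma t + p) ^+ 2 + expR (u t) ^+ 2) - w).
Proof.
move=> s0 ds du.
have dS : is_derive t 1 (fun s => sigma s + p) v.
  by apply: is_derive_eq (is_deriveD ds (is_derive_cst p t 1)) _; rewrite addr0.
have dE : is_derive t 1 (expR \o u) (expR (u t) * w).
  exact: is_derive1_comp (is_derive_expR _) du.
pose W s := (sigma s + p) ^+ 2 + expR (u s) ^+ 2.
have dW : is_derive t 1 W (2 * (sigma t + p) * v + 2 * expR (u t) ^+ 2 * w).
  apply: is_derive_eq (is_deriveD (is_deriveM dS dS) (is_deriveM dE dE)) _.
  by rewrite /= /GRing.scale/=; ring.
have W0 : 0 < W t by rewrite ltr_pwDl ?sqr_ge0// exprn_gt0.
have dL : is_derive t 1 (@ln R \o W) _ := is_derive1_comp (is_derive1_ln W0) dW.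
by apply: is_derive_eq (is_deriveB dL du) _; rewrite mulrC.
Qed.

(** A path of the half-plane, given by its logarithmic height [u] and by the
    speed [v] of its abscissa, is at least as long as the geodesic: along it,
    the Busemann function of an end of that geodesic grows at most as fast as
    the arc length, since its gradient has norm one, and on the geodesic it
    grows exactly as fast. *)
Lemma half_plane_path_length a b (u w v phi : R -> R) : a < b ->
  abs_continuous a b u ->
  (forall t, 0 <= v t) -> mu.-integrable [set: R] (EFin \o v) ->
  (forall t, 0 <= phi t) -> mu.-integrable [set: R] (EFin \o phi) ->
  {ae mu, forall t, a < t < b -> is_derive t 1 u (w t)} ->
  (forall t, a < t < b ->
    Num.sqrt (w t ^+ 2 + (expR (- u t) * v t) ^+ 2) <= phi t) ->
  arccosh (half_plane_cosh (u a) (u b) (primitive a v b)) <= primitive a phi b.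
Proof.
move=> ab acu v0 vint phi0 phiint du wv_phi.
have aeF := ae_filter_ringOfSetsType mu.
have phi_incr (g : R -> R) : abs_continuous a b g ->
    {ae mu, forall t, a < t < b -> exists2 g', is_derive t 1 g g' & g' <= phi t} ->
    g b - g a <= primitive a phi b.
  move=> acg dg.
  have -> : primitive a phi b = primitive a phi b - primitive a phi a.
    by rewrite primitive_refl subr0.
  apply: abs_continuous_increment_le => //; first exact: ltW.
    by move=> x y _ _; exact: primitive_le.
  apply: (filterS2 _ _ dg (primitive_ae_is_derive a phiint)).
  move=> t /= dgt dphi tab; have [g' dg' g'phi] := dgt tab.
  exists g', (phi t); split => //; apply: dphi.
  by have /andP[] := tab.
have w_phi t : a < t < b -> `|w t| <= phi t.
  move=> tab; apply: le_trans (wv_phi t tab).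
  by rewrite -sqrtr_sqr ler_wsqrtr// lerDl sqr_ge0.
have l_ge0 : 0 <= primitive a v b.
  by rewrite -(primitive_refl a v) primitive_le// ltW.
have [l0|] := leP (primitive a v b) 0.
  (* on a vertical geodesic, u and - u play the part of the Busemann function *)
  have -> : primitive a v b = 0 by apply/eqP; rewrite eq_le l0.
  rewrite /half_plane_cosh expr0n/= mulr0 mul0r addr0 arccosh_cosh.
  rewrite distrC ler_norml lerNl opprB; apply/andP; split.
    have := phi_incr (\- u); rewrite /= opprK addrC; apply.
      apply: (abs_continuous_lipschitz (K := 1) acu) => x y _ _ _.
      by rewrite mul1r -opprD normrN.
    apply: filterS du => t /= dut tab; exists (- w t).
      by apply: is_deriveN; exact: dut.
    by rewrite (le_trans _ (w_phi t tab))// -normrN ler_norm.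
  apply: phi_incr => //; apply: filterS du => t /= dut tab.
  by exists (w t); [exact: dut|rewrite (le_trans _ (w_phi t tab))// ler_norm].
set l := primitive a v b => l_gt0.
have [p [q [p0 q0 uaE ubE ->]]] := half_plane_circle (u a) (u b) l_gt0.
pose sigma := primitive a v.
have sigma_ge0 t : a <= t -> 0 <= sigma t.
  by move=> at_; rewrite -(primitive_refl a v) primitive_le.
pose g t := ln ((sigma t + p) ^+ 2 + expR (u t) ^+ 2) - u t.
have -> : (ln (p + l) - ln q) / 2 - (ln p - ln (l + q)) / 2 = g b - g a.
  have lq0 : 0 < l + q by rewrite addr_gt0.
  have pl0 : 0 < p + l by rewrite addr_gt0.
  have plq0 : 0 < p + l + q by rewrite addr_gt0.
  have Eu z z' t : 0 < z -> 0 < z' -> u t = (ln z + ln z') / 2 ->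
      expR (u t) ^+ 2 = z * z'.
    move=> z0 z'0 ->; rewrite expr2 -expRD -splitr expRD !lnK ?posrE//.
  rewrite /g (Eu _ _ _ p0 lq0 uaE) (Eu _ _ _ pl0 q0 ubE) /sigma primitive_refl -/l.
  rewrite (_ : (l + p) ^+ 2 + _ = (p + l) * (p + l + q)); last by ring.
  rewrite (_ : (0 + p) ^+ 2 + _ = p * (p + l + q)); last by ring.
  rewrite !lnM ?posrE// [in RHS]uaE [in RHS]ubE; lra.
apply: phi_incr.
  have [M uM] := abs_continuous_bounded ab acu.
  have acsigma := primitive_abs_continuous a v0 vint b.
  have acW : abs_continuous a b
      ((fun t => (sigma t + p) ^+ 2) \+ (fun t => expR (u t) ^+ 2)).
    apply: abs_continuous_add; apply: abs_continuous_sqr => //.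
      apply: (abs_continuous_lipschitz (K := 1) acsigma) => x y _ _ _.
      by rewrite mul1r opprD addrACA subrr addr0.
    apply: (abs_continuous_expR (M := M)) => // t tab.
    by rewrite (le_trans (ler_norm _))// uM.
  have acl : abs_continuous a b (fun t => ln ((sigma t + p) ^+ 2 + expR (u t) ^+ 2)).
    apply: (abs_continuous_ln (m := p ^+ 2)) acW => [|t /andP[at_ _]].
      by rewrite exprn_gt0.
    have st0 := sigma_ge0 t at_.
    by rewrite ler_wpDr ?sqr_ge0// lerXn2r ?nnegrE ?lerDr// ?addr_ge0// ltW.
  apply: (abs_continuous_dominated (K := 1) acl acu) => x y _ _ _.
  rewrite mul1r (distrC (u y)); apply: le_trans (ler_normD _ _).
  by rewrite le_eqVlt; apply/orP; left; apply/eqP; congr (`|_|); rewrite /g; ring.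
apply: (filterS2 _ _ du (primitive_ae_is_derive a vint)) => t /= dut dst tab.
have /andP[at_ tb] := tab.
have sp0 : 0 < sigma t + p by rewrite ltr_wpDl// sigma_ge0// ltW.
eexists; first by apply: is_derive_busemann sp0 (dst at_) (dut tab).
apply: le_trans (wv_phi t tab).
(* (Y^2 - S^2, 2 S Y) has norm S^2 + Y^2, whence a gradient of norm one *)
set S := sigma t + p in sp0 *; rewrite expRN.
have := expR_gt0 (u t); set Y := expR (u t) => Y0.
have W0 : 0 < S ^+ 2 + Y ^+ 2 by rewrite ltr_pwDl ?sqr_ge0// exprn_gt0.
have -> : (2 * S * v t + 2 * Y ^+ 2 * w t) / (S ^+ 2 + Y ^+ 2) - w t =
   ((Y ^+ 2 - S ^+ 2) * w t + 2 * S * Y * (Y^-1 * v t)) / (S ^+ 2 + Y ^+ 2).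
  by field; rewrite !gt_eqF.
rewrite ler_pdivrMr// [leRHS]mulrC; apply: cauchy_schwarz2; first exact: ltW.
by ring.
Qed.

End HalfPlanePath.

(** * Length of horizontal curves *)

Section Speed.
Context {R : realType}.
Notation mu := (@lebesgue_measure R).

Definition speed n (c : 'I_n -> R -> R) (t : R) : R :=
  Num.sqrt (\sum_i c i t ^+ 2).

Lemma speed_ge0 n (c : 'I_n -> R -> R) t : 0 <= speed c t.
Proof. exact: sqrtr_ge0. Qed.

Lemma sqr_speed n (c : 'I_n -> R -> R) t : speed c t ^+ 2 = \sum_i c i t ^+ 2.
Proof. by rewrite sqr_sqrtr// sumr_ge0// => i _; exact: sqr_ge0. Qed.

Lemma measurable_speed n (c : 'I_n -> R -> R) (D : set R) : measurable D ->
  (forall i, measurable_fun D (c i)) -> measurable_fun D (speed c).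
Proof.
move=> mD mc.
have ms : measurable_fun setT (@Num.sqrt R).
  by apply: continuous_measurable_fun; exact: sqrt_continuous.
apply: measurableT_comp => //.
by apply: measurable_sum => i; exact: measurable_funX.
Qed.

Lemma restrict_ge0 (D : set R) (phi : R -> R) t :
  (forall t, 0 <= phi t) -> 0 <= (phi \_ D) t.
Proof. by move=> phi0; rewrite patchE; case: ifP. Qed.

Lemma restrict_itvE (a b : R) (phi : R -> R) t :
  a <= t <= b -> (phi \_ `[a, b]) t = phi t.
Proof. by move=> tab; rewrite patchE mem_set//= in_itv. Qed.

Lemma restrict_integrable (D : set R) (phi : R -> R) : measurable D ->
  mu.-integrable D (EFin \o phi) -> mu.-integrable [set: R] (EFin \o (phi \_ D)).
Proof.
move=> mD ip; rewrite -restrict_EFin.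
apply ((@integrable_mkcond _ _ _ mu D (EFin \o phi) mD).1 ip).
Qed.

Lemma integral_itv_primitive (a b : R) (phi : R -> R) :
  mu.-integrable `[a, b] (EFin \o phi) ->
  (\int[mu]_(t in `[a, b]) (phi t)%:E = (primitive a (phi \_ `[a, b]) b)%:E)%E.
Proof.
move=> iphi.
have iphi' : mu.-integrable `]a, b] (EFin \o phi).
  by apply: integrableS iphi => //; exact: subset_itv_oc_cc.
have mphi : measurable_fun `]a, b] (EFin \o phi) by case/integrableP : iphi'.
rewrite -integral_itv_obnd_cbnd// -[LHS]fineK; last exact: integrable_fin_num.
congr EFin; rewrite /primitive /Rintegral; congr fine.
apply: eq_integral => x; rewrite inE/= in_itv/= => /andP[ax xb].
by rewrite restrict_itvE// xb ltW.
Qed.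

Lemma integrable_le (D : set R) K (f g : R -> R) : measurable D ->
  measurable_fun D f -> (forall t, D t -> 0 <= f t <= K * g t) ->
  mu.-integrable D (EFin \o g) -> mu.-integrable D (EFin \o f).
Proof.
move=> mD mf fg ig.
have ikg := @integrableZl _ _ R mu D mD K _ ig.
apply: (@le_integrable _ _ R mu D mD) ikg => //.
- exact/measurable_EFinP.
- move=> t Dt; have /andP[f0 fK] := fg t Dt.
  by rewrite /= lee_fin !ger0_norm// (le_trans f0).
Qed.

End Speed.

Section CCLength.
Context {R : realType}.
Notation mu := (@lebesgue_measure R).

Lemma cc_length_speed n (c : 'I_n -> R -> R) (a b : R) :
  cc_length a b c = (\int[mu]_(t in `[a, b]) (speed c t)%:E)%E.
Proof. by []. Qed.

Lemma cc_length_ge0 n (c : 'I_n -> R -> R) (a b : R) : (0 <= cc_length a b c)%E.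
Proof. by apply: integral_ge0 => t _; rewrite lee_fin sqrtr_ge0. Qed.

Lemma speed_integrable n (c : 'I_n -> R -> R) (a b l : R) :
  (forall i, measurable_fun `[a, b] (c i)) -> cc_length a b c = l%:E ->
  mu.-integrable `[a, b] (EFin \o speed c).
Proof.
move=> mc cl; apply/integrableP; split.
  by apply/measurable_EFinP; exact: measurable_speed.
rewrite (@eq_integral _ _ _ mu `[a, b] (EFin \o speed c)).
  by rewrite -[X in (X < _)%E]cc_length_speed cl ltry.
by move=> t _; rewrite /= ger0_norm// speed_ge0.
Qed.

Lemma speed_recl n (c : 'I_n.+1 -> R -> R) t :
  speed c t = Num.sqrt (c ord0 t ^+ 2 + speed (fun j => c (lift ord0 j)) t ^+ 2).
Proof. by rewrite sqr_speed /speed big_ord_recl. Qed.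

Lemma speed_scale n (k : R -> R) (c : 'I_n -> R -> R) t : 0 <= k t ->
  speed (fun i s => k s * c i s) t = k t * speed c t.
Proof.
move=> k0; rewrite /speed; under eq_bigr do rewrite exprMn.
by rewrite -mulr_sumr sqrtrM ?sqr_ge0// sqrtr_sqr ger0_norm.
Qed.

Lemma cc_length_primitive n (c : 'I_n -> R -> R) (a b : R) :
  mu.-integrable `[a, b] (EFin \o speed c) ->
  cc_length a b c = (primitive a (speed c \_ `[a, b]) b)%:E.
Proof. by move=> ic; rewrite cc_length_speed integral_itv_primitive. Qed.

End CCLength.

Section CCDist.
Context {R : realType} {V : normedModType R} {n : nat}.
Implicit Types (X : 'I_n -> V -> V) (x y : V).

Lemma cc_dist_ge0 X x y : (0 <= cc_dist X x y)%E.
Proof.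
by apply/ereal_infP => _ [a [b [f [c [_ _ _ _ ->]]]]]; exact: cc_length_ge0.
Qed.

Lemma cc_dist_le X (a b : R) (f : R -> V) c : a < b ->
  horizontal X a b f c -> (cc_dist X (f a) (f b) <= cc_length a b c)%E.
Proof. by move=> ab hf; apply: ereal_inf_lbound; exists a, b, f, c. Qed.

End CCDist.

(** * Warped products with a line *)

Section DerivePair.
Context {R : realType} {U V : normedModType R}.

(** This form of the difference quotient passes to pairs and projections by
    continuity alone. *)
Lemma is_derive_cvgP (W : normedModType R) (f : R -> W) (t : R) (df : W) :
  is_derive t 1 f df <-> h^-1 *: (f (h + t) - f t) @[h --> 0^'] --> df.
Proof.
have E : (fun h : R => h^-1 *: ((f \o shift t) (h *: (1 : R)) - f t)) =
    (fun h => h^-1 *: (f (h + t) - f t)).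
  by apply/funext => h /=; rewrite [h *: _]mulr1.
split=> [[df1 df2]|cf].
  move/cvg_ex : df1 => [l]; rewrite E => cl.
  by rewrite -df2 /derive E (cvg_lim (@norm_hausdorff _ _) cl).
have cf' : (fun h : R => h^-1 *: ((f \o shift t) (h *: (1 : R)) - f t)) @ 0^' --> df.
  by rewrite E.
split; first by apply/cvg_ex; exists df.
by rewrite /derive; exact: (cvg_lim (@norm_hausdorff _ _) cf').
Qed.

Lemma is_derive_pair (f : R -> U) (g : R -> V) (t : R) df dg :
  is_derive t 1 f df -> is_derive t 1 g dg ->
  is_derive t 1 (fun s => (f s, g s)) (df, dg).
Proof.
move=> /is_derive_cvgP cf /is_derive_cvgP cg; apply/is_derive_cvgP.
exact: cvg_pair.
Qed.

Lemma is_derive_fst (f : R -> U * V) (t : R) df :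
  is_derive t 1 f df -> is_derive t 1 (fst \o f) df.1.
Proof.
move=> /is_derive_cvgP cf; apply/is_derive_cvgP.
have cfst : @fst U V @ df --> df.1 by exact: cvg_fst.
exact: cvg_comp cf cfst.
Qed.

Lemma is_derive_snd (f : R -> U * V) (t : R) df :
  is_derive t 1 f df -> is_derive t 1 (snd \o f) df.2.
Proof.
move=> /is_derive_cvgP cf; apply/is_derive_cvgP.
have csnd : @snd U V @ df --> df.2 by exact: cvg_snd.
exact: cvg_comp cf csnd.
Qed.

Lemma norm_fst_le (x : U * V) : `|x.1| <= `|x|.
Proof. by rewrite prod_normE le_max lexx. Qed.

Lemma norm_snd_le (x : U * V) : `|x.2| <= `|x|.
Proof. by rewrite prod_normE le_max lexx orbT. Qed.

Lemma norm_pair_le (x : U * V) : `|x| <= `|x.1| + `|x.2|.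
Proof. by rewrite prod_normE ge_max lerDl lerDr !normr_ge0. Qed.

End DerivePair.

Section WarpedFrame.
Context {R : realType} {V : normedModType R} {q : nat}.
Variable X : 'I_q -> V -> V.

(** On [V * R], the vertical field followed by the fields [X j] stretched by
    [e^u]: this frame is orthonormal for the warped product metric
    [du^2 + e^(-2u) dz^2]. *)
Definition warped_frame (i : 'I_q.+1) (g : V * R) : V * R :=
  if unlift ord0 i is Some j then (expR g.2 *: X j g.1, 0) else (0, 1).

Lemma warped_velocity (c : 'I_q.+1 -> R) (g : V * R) :
  \sum_i c i *: warped_frame i g =
    (\sum_j (expR g.2 * c (lift ord0 j)) *: X j g.1, c ord0).
Proof.
rewrite big_ord_recl {1}/warped_frame unlift_none.
have -> : \sum_(j < q) c (lift ord0 j) *: warped_frame (lift ord0 j) g =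
    (\sum_j (expR g.2 * c (lift ord0 j)) *: X j g.1, 0).
  apply: (big_ind2 (fun (x : V * R) (y : V) => x = (y, 0))) => //.
    by move=> _ y _ y' -> ->; apply/pair_equal_spec; rewrite /= addr0.
  move=> j _; rewrite /warped_frame liftK; apply/pair_equal_spec; split => /=.
    by rewrite scalerA mulrC.
  by rewrite scaler0.
apply/pair_equal_spec; split => /=; first by rewrite scaler0 add0r.
by rewrite addr0; exact: mulr1.
Qed.

End WarpedFrame.

Section WarpedDistance.
Context {R : realType} {V : normedModType R} {q : nat}.
Variable X : 'I_q -> V -> V.
Notation mu := (@lebesgue_measure R).

(** The projection of a curve to [V] is horizontal, and the pair formed by its
    length so far and by the height [u] is a path of the half-plane that has
    the same speed as the curve. *)
Lemma warped_length_ge (a b l : R) (F : R -> V * R) c : a < b ->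
  horizontal (warped_frame X) a b F c -> cc_length a b c = l%:E ->
  exists c' l', [/\ horizontal X a b (fst \o F) c', cc_length a b c' = l'%:E &
    arccosh (half_plane_cosh (F a).2 (F b).2 l') <= l].
Proof.
move=> ab [acF mc dF] cl.
have aeF := ae_filter_ringOfSetsType mu.
pose u := snd \o F.
have acu : abs_continuous a b u.
  apply: (abs_continuous_lipschitz (K := 1) acF) => x y _ _ _.
  by rewrite mul1r; exact: (norm_snd_le (F y - F x)).
have mu_ : measurable_fun `[a, b] u.
  by apply: subspace_continuous_measurable_fun => //; exact: abs_continuous_within.
have [M uM] := abs_continuous_bounded ab acu.
pose cN j := c (lift ord0 j).
pose c' (j : 'I_q) t := expR (u t) * cN j t.
have mc' j : measurable_fun `[a, b] (c' j).
  by apply: measurable_funM; [exact: measurableT_comp|exact: mc].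
have ic := speed_integrable mc cl.
have speed_c' t : speed c' t = expR (u t) * speed cN t.
  by apply: speed_scale; exact: expR_ge0.
have ic' : mu.-integrable `[a, b] (EFin \o speed c').
  apply: (integrable_le (K := expR M)) ic => //; first exact: measurable_speed.
  move=> t /=; rewrite in_itv/= => tab; rewrite speed_ge0/= speed_c'.
  apply: ler_pM; rewrite ?expR_ge0 ?speed_ge0//.
    by rewrite ler_expR (le_trans (ler_norm _))// uM.
  rewrite speed_recl -[leLHS]ger0_norm ?speed_ge0// -sqrtr_sqr ler_wsqrtr//.
  by rewrite lerDr sqr_ge0.
exists c', (primitive a (speed c' \_ `[a, b]) b); split.
- split => //.
    apply: (abs_continuous_lipschitz (K := 1) acF) => x y _ _ _.
    by rewrite mul1r; exact: (norm_fst_le (F y - F x)).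
  apply: filterS dF => t /= dF tab.
  by have := is_derive_fst (dF tab); rewrite warped_velocity.
- exact: cc_length_primitive.
- have -> : l = primitive a (speed c \_ `[a, b]) b.
    by apply: EFin_inj; rewrite -cl cc_length_primitive.
  apply: (@half_plane_path_length _ a b u (c ord0)) => //.
  + by move=> t; apply: restrict_ge0; exact: speed_ge0.
  + exact: restrict_integrable.
  + by move=> t; apply: restrict_ge0; exact: speed_ge0.
  + exact: restrict_integrable.
  + apply: filterS dF => t /= dF tab.
    by have := is_derive_snd (dF tab); rewrite warped_velocity.
  + move=> t /andP[/ltW at_ /ltW tb].
    rewrite !restrict_itvE ?at_// speed_c' mulrA -expRD addNr expR0 mul1r.
    by rewrite -speed_recl.
Qed.

(** A curve of [V] of length less than [l'] is lifted by prescribing the height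
    as a function of the length covered so far, so that the pair of both runs
    along the geodesic of the half-plane. Composing with this length, an
    absolutely continuous function of the given parameter, avoids
    reparametrizing the curve by arc length. *)
Lemma warped_lift (a b l l' u0 u1 : R) (f : R -> V) c : a < b ->
  horizontal X a b f c -> cc_length a b c = l%:E -> l < l' ->
  exists F c', [/\ F a = (f a, u0), F b = (f b, u1),
    horizontal (warped_frame X) a b F c' &
    (cc_length a b c' <= (arccosh (half_plane_cosh u0 u1 l'))%:E)%E].
Proof.
move=> ab [acf mc df] cl ll'.
have aeF := ae_filter_ringOfSetsType mu.
(* The abscissa runs at speed v0, the speed of the curve plus eta > 0. It ends
   exactly at l', which is positive even if the curve has length zero. *)
pose eta := (l' - l) / (b - a).
have ba0 : 0 < b - a by rewrite subr_gt0.
have eta0 : 0 < eta by rewrite divr_gt0// subr_gt0.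
have ic := speed_integrable mc cl.
pose v0 t := speed c t + eta.
have v0_gt0 t : 0 < v0 t by rewrite ltr_wpDl// speed_ge0.
have iv0 : mu.-integrable `[a, b] (EFin \o v0).
  have ieta : mu.-integrable `[a, b] (EFin \o cst eta).
    apply: continuous_compact_integrable; first exact: segment_compact.
    by apply: continuous_subspaceT => x; exact: cvg_cst.
  exact: (@integrableD _ _ R mu `[a, b] _ _ _ ic ieta).
pose rho := primitive a (speed c \_ `[a, b]).
have rc_ge0 t : 0 <= (speed c \_ `[a, b]) t by apply: restrict_ge0; exact: speed_ge0.
have irc : mu.-integrable [set: R] (EFin \o (speed c \_ `[a, b])).
  exact: restrict_integrable.
pose sigma t := rho t + eta * (t - a).
have sigma_a : sigma a = 0 by rewrite /sigma /rho primitive_refl subrr mulr0 addr0.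
have sigma_b : sigma b = l'.
  rewrite /sigma /rho; have -> : primitive a (speed c \_ `[a, b]) b = l.
    by apply: EFin_inj; rewrite -cl cc_length_primitive.
  by rewrite /eta divfK ?gt_eqF// addrC subrK.
have sigma_le x y : x <= y -> sigma x <= sigma y.
  by move=> xy; rewrite lerD ?primitive_le// ler_pM2l// lerD2r.
have acsigma : abs_continuous a b sigma.
  have acid : abs_continuous a b (id : R -> R).
    move=> e e0; exists e => // m s t st _.
    apply: le_lt_trans; apply: ler_sum => i _.
    by have [_ st' _] := st i; rewrite ger0_norm// subr_ge0.
  have acrho := primitive_abs_continuous a rc_ge0 irc b.
  apply: (abs_continuous_dominated (K := 1 + eta) acrho acid).
  move=> x y _ _ _; rewrite /sigma -/rho.
  rewrite (_ : _ - _ = (rho y - rho x) + eta * (y - x)); last by ring.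
  apply: le_trans (ler_normD _ _) _.
  rewrite normrM (gtr0_norm eta0) mulrDl mul1r mulrDr.
  have := mulr_ge0 (ltW eta0) (normr_ge0 (rho y - rho x)).
  by have := normr_ge0 (y - x); rewrite /=; lra.
have l'0 : 0 < l'.
  by apply: le_lt_trans ll'; rewrite -lee_fin -cl cc_length_ge0.
have [p [w [p0 w0 u0E u1E ->]]] := half_plane_circle u0 u1 l'0.
(* A and B are the logarithms of the distances from the abscissa to the ends
   of the circle, u is the logarithm of the height on the geodesic and s an arc
   length parameter; k and K are the derivatives of u and s with respect to the
   abscissa *)
pose A t := ln (p + sigma t); pose B t := ln (l' + w - sigma t).
have sigma_ge0 t : a <= t -> 0 <= sigma t by move=> at_; rewrite -sigma_a sigma_le.
have sigma_lel t : t <= b -> sigma t <= l' by move=> tb; rewrite -sigma_b sigma_le.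
have acA : abs_continuous a b A.
  apply: (abs_continuous_ln p0) => [t /andP[at_ tb]|].
    by rewrite lerDl sigma_ge0.
  apply: (abs_continuous_lipschitz (K := 1) acsigma) => x y _ _ _.
  by rewrite mul1r opprD addrACA subrr add0r.
have acB : abs_continuous a b B.
  apply: (abs_continuous_ln w0) => [t /andP[at_ tb]|].
    by have := sigma_lel _ tb; lra.
  apply: (abs_continuous_lipschitz (K := 1) acsigma) => x y _ _ _.
  by rewrite mul1r (distrC (sigma y)) (_ : _ - _ = sigma x - sigma y)//; ring.
have mA : measurable_fun `[a, b] A.
  by apply: subspace_continuous_measurable_fun => //; exact: abs_continuous_within.
have mB : measurable_fun `[a, b] B.
  by apply: subspace_continuous_measurable_fun => //; exact: abs_continuous_within.
pose u t := (A t + B t) / 2; pose s t := (A t - B t) / 2.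
pose k t := (expR (- A t) - expR (- B t)) / 2.
pose K t := (expR (- A t) + expR (- B t)) / 2.
pose c' (i : 'I_q.+1) t :=
  if unlift ord0 i is Some j then expR (- u t) * c j t else k t * v0 t.
have c'0 t : c' ord0 t = k t * v0 t by rewrite /c' unlift_none.
have c'S j t : c' (lift ord0 j) t = expR (- u t) * c j t by rewrite /c' liftK.
have mc' i : measurable_fun `[a, b] (c' i).
  rewrite /c'; case: unliftP => [j|] _.
    apply: measurable_funM => //; apply: measurableT_comp => //.
    apply: measurableT_comp => //.
    by apply: measurable_funM => //; exact: measurable_funD.
  apply: measurable_funM; last first.
    by apply: measurable_funD => //; exact: measurable_speed.
  apply: measurable_funM => //.
  by apply: measurable_funB; do 2!apply: measurableT_comp => //.
have speed_c' t : speed c' t <= K t * v0 t.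
  rewrite speed_recl c'0.
  have -> : speed (fun j => c' (lift ord0 j)) t = expR (- u t) * speed c t.
    rewrite -(@speed_scale _ _ (fun r => expR (- u r))) ?expR_ge0// /speed.
    congr Num.sqrt.
    by apply: eq_bigr => j _; rewrite c'S.
  have K0 : 0 <= K t by rewrite divr_ge0// addr_ge0 ?expR_ge0.
  have Kv0 : 0 <= K t * v0 t by rewrite mulr_ge0// ltW.
  rewrite -(ger0_norm Kv0) -sqrtr_sqr ler_wsqrtr//.
  have -> : (K t * v0 t) ^+ 2 = (k t * v0 t) ^+ 2 + (expR (- u t) * v0 t) ^+ 2.
    rewrite !exprMn -mulrDl; congr (_ * _).
    have -> : expR (- u t) ^+ 2 = expR (- A t) * expR (- B t).
      by rewrite expr2 -!expRD; congr expR; rewrite /u; field.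
    by rewrite /K /k; field.
  rewrite lerD2l lerXn2r ?nnegrE ?mulr_ge0 ?expR_ge0 ?speed_ge0//; first exact: ltW.
  by rewrite ler_wpM2l ?expR_ge0// lerDl ltW.
have K_le t : a <= t <= b -> K t <= (p^-1 + w^-1) / 2.
  move=> /andP[at_ tb]; have := sigma_ge0 _ at_; have := sigma_lel _ tb => s1 s2.
  by rewrite /K ler_pM2r ?invr_gt0// !expRN !lnK ?posrE ?lerD ?lef_pV2 ?posrE//; lra.
have ic' : mu.-integrable `[a, b] (EFin \o speed c').
  apply: (integrable_le (K := (p^-1 + w^-1) / 2)) iv0 => //.
    exact: measurable_speed.
  move=> t /=; rewrite in_itv/= => tab; rewrite speed_ge0/=.
  by apply: le_trans (speed_c' t) _; rewrite ler_wpM2r ?K_le// ltW.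
have duS : {ae mu, forall t, a < t < b ->
    is_derive t 1 u (k t * v0 t) /\ is_derive t 1 s (K t * v0 t)}.
  apply: filterS (primitive_ae_is_derive a irc) => t /= drho tab.
  have /andP[at_ tb] := tab.
  have := sigma_ge0 _ (ltW at_); have := sigma_lel _ (ltW tb) => s1 s2.
  have dsigma : is_derive t 1 sigma (v0 t).
    have did : is_derive t 1 (fun r : R => eta * (r - a)) eta.
      have dB := is_deriveB (is_derive_id t 1) (is_derive_cst a t 1).
      apply: is_derive_eq (is_deriveZ eta dB) _.
      by rewrite subr0; exact: mulr1.
    apply: is_derive_eq (is_deriveD (drho at_) did) _.
    by rewrite restrict_itvE ?(ltW at_) ?(ltW tb).
  have dA : is_derive t 1 A (expR (- A t) * v0 t).
    have ps0 : 0 < p + sigma t by lra.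
    have dps : is_derive t 1 (fun r => p + sigma r) (v0 t).
      apply: is_derive_eq (is_deriveD (is_derive_cst p t 1) dsigma) _.
      by rewrite add0r.
    have := @is_derive1_comp _ (@ln R) _ t _ _ (is_derive1_ln ps0) dps.
    by rewrite expRN lnK ?posrE.
  have dB : is_derive t 1 B (- (expR (- B t) * v0 t)).
    have ps0 : 0 < l' + w - sigma t by lra.
    have dps : is_derive t 1 (fun r => l' + w - sigma r) (- v0 t).
      apply: is_derive_eq (is_deriveB (is_derive_cst (l' + w) t 1) dsigma) _.
      by rewrite sub0r.
    have := @is_derive1_comp _ (@ln R) _ t _ _ (is_derive1_ln ps0) dps.
    by rewrite mulrN expRN lnK ?posrE.
  have half (h : R -> R) dh :
      is_derive t 1 h dh -> is_derive t 1 (fun r => h r / 2) (dh / 2).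
    move=> dh_; have := is_deriveZ 2^-1 dh_; rewrite /GRing.scale/= mulrC.
    by congr is_derive; apply/funext => r; rewrite /= mulrC.
  split.
    by apply: is_derive_eq (half _ _ (is_deriveD dA dB)) _; rewrite /k; ring.
  by apply: is_derive_eq (half _ _ (is_deriveB dA dB)) _; rewrite /K; ring.
exists (fun t => (f t, u t)), c'; split.
- by rewrite /u /A /B sigma_a addr0 subr0 -u0E.
- by rewrite /u /A /B sigma_b addrAC subrr add0r -u1E.
- split => //.
    have acu : abs_continuous a b u.
      apply: (abs_continuous_dominated (K := 1) acA acB) => x y _ _ _.
      rewrite mul1r (_ : u y - u x = (A y - A x) / 2 + (B y - B x) / 2); last first.
        by rewrite /u; field.
      apply: le_trans (ler_normD _ _) _; rewrite !normrM normfV normr_nat.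
      by have := normr_ge0 (A y - A x); have := normr_ge0 (B y - B x); lra.
    apply: (abs_continuous_dominated (K := 1) acf acu) => x y _ _ _.
    by rewrite mul1r; exact: (norm_pair_le ((f y, u y) - (f x, u x))).
  apply: filterS2 df duS => t /= df duS tab.
  rewrite warped_velocity /= c'0.
  apply: is_derive_eq (is_derive_pair (df tab) (duS tab).1) _.
  congr (_, _); apply: eq_bigr => j _.
  by rewrite c'S mulrA -expRD subrr expR0 mul1r.
- rewrite cc_length_primitive// lee_fin.
  have ic'r := restrict_integrable (measurable_itv `[a, b]) ic'.
  have c'r_ge0 t : 0 <= (speed c' \_ `[a, b]) t.
    by apply: restrict_ge0; exact: speed_ge0.
  have -> : (ln (p + l') - ln w) / 2 = s b.
    by rewrite /s /A /B sigma_b addrAC subrr add0r.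
  have -> : (ln p - ln (l' + w)) / 2 = s a.
    by rewrite /s /A /B sigma_a addr0 subr0.
  rewrite -[leLHS]subr0 -[X in _ - X](primitive_refl a (speed c' \_ `[a, b])).
  apply: abs_continuous_increment_le; first exact: ltW.
  + exact: primitive_abs_continuous.
  + move=> x y; rewrite !in_itv/= => /andP[ax xb] /andP[ay yb] xy.
    have := sigma_le _ _ xy; have := sigma_ge0 _ ax; have := sigma_lel _ yb.
    move=> s1 s2 s3.
    rewrite /s ler_pM2r ?invr_gt0// lerB// ler_ln ?posrE; lra.
  + apply: filterS2 duS (primitive_ae_is_derive a ic'r) => t /= duS dP tab.
    exists (speed c' t), (K t * v0 t); split => //.
      have /andP[at_ tb] := tab; have := dP at_.
      by rewrite restrict_itvE// (ltW at_) ltW.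
    exact: (duS tab).2.
Qed.

(** If [cc_dist X z0 z1] is [+oo] so is the distance in the warped product,
    because curves of finite length project to curves of finite length. If it
    is finite, the lifts give the upper bound at every [l > cc_dist X z0 z1],
    and continuity of [arccosh] gives it at [cc_dist X z0 z1]. *)
Lemma warped_cc_dist (z0 z1 : V) (u0 u1 : R) :
  (cc_dist (warped_frame X) (z0, u0) (z1, u1) =
     arccoshe ((cosh (u0 - u1))%:E +
       (expR (- (u0 + u1)))%:E * cc_dist X z0 z1 ^+ 2 / 2%:E))%E.
Proof.
have lower l : [set l | exists a b F c, [/\ a < b, F a = (z0, u0), F b = (z1, u1),
      horizontal (warped_frame X) a b F c & l = cc_length a b c]] l ->
    l = +oo%E \/ exists r l', [/\ l = r%:E, (cc_dist X z0 z1 <= l'%:E)%E &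
       arccosh (half_plane_cosh u0 u1 l') <= r].
  move=> [a [b [F [c [ab Fa Fb hF lE]]]]].
  have := cc_length_ge0 c a b; rewrite -lE.
  case: l lE => // [r rE _|_ _]; last by left.
  have [c' [l' [hf cl' le_r]]] := warped_length_ge ab hF (esym rE).
  right; exists r, l'; split => //; last by move: le_r; rewrite Fa Fb.
  by rewrite -cl'; have := cc_dist_le ab hf; rewrite /= Fa Fb.
have upper (l : R) : (cc_dist X z0 z1 < l%:E)%E ->
    (cc_dist (warped_frame X) (z0, u0) (z1, u1) <=
      (arccosh (half_plane_cosh u0 u1 l))%:E)%E.
  move=> /ereal_inf_lt[l0 [a [b [f [c [ab fa fb hf ->]]]]]].
  have := cc_length_ge0 c a b; case cl : (cc_length a b c) => [r| |]// _.
  rewrite lte_fin => rl.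
  have [F [c' [Fa Fb hF]]] := warped_lift u0 u1 ab hf cl rl.
  by apply: le_trans; have := cc_dist_le ab hF; rewrite Fa Fb fa fb.
have := cc_dist_ge0 X z0 z1; case dE : (cc_dist X z0 z1) => [r| |]// r_ge0.
  have -> : (arccoshe ((cosh (u0 - u1))%:E +
        (expR (- (u0 + u1)))%:E * r%:E ^+ 2 / 2%:E) =
      (arccosh (half_plane_cosh u0 u1 r))%:E)%E.
    by rewrite inver pnatr_eq0/=.
  rewrite lee_fin in r_ge0.
  apply/eqP; rewrite eq_le; apply/andP; split; last first.
    apply/ereal_infP => l /lower[->|[s [l' [-> dl' le_s]]]]; first by rewrite leey.
    rewrite lee_fin (le_trans _ le_s)// arccosh_le ?half_plane_cosh_ge1//.
    by rewrite half_plane_cosh_le// -lee_fin -dE.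
  have dfin : cc_dist (warped_frame X) (z0, u0) (z1, u1) \is a fin_num.
    rewrite ge0_fin_numE ?cc_dist_ge0// (le_lt_trans (upper (r + 1) _)) ?ltry//.
    by rewrite dE lte_fin ltrDl.
  rewrite -(fineK dfin) in upper *; rewrite lee_fin leNgt; apply/negP => lt_d.
  near r^'+ => l.
  have : fine (cc_dist (warped_frame X) (z0, u0) (z1, u1)) <=
      arccosh (half_plane_cosh u0 u1 l).
    by rewrite -lee_fin upper// dE lte_fin.
  rewrite leNgt => /negP; apply; near: l.
  apply: cvgr_lt lt_d; apply: cvg_at_right_filter.
  exact: arccosh_half_plane_cosh_continuous.
rewrite expe2 mulyy gt0_muley ?lte_fin ?expR_gt0// inver pnatr_eq0 gt0_mulye//.
rewrite addey//=; apply/eqP; rewrite -leye_eq.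
apply/ereal_infP => l /lower[->//|[s [l' [_ + _]]]].
by rewrite dE leye_eq.
Unshelve. all: by end_near. Qed.

End WarpedDistance.

Theorem proposition2p7 (R : realType) (d q : nat) (N : stratified_group R d)
  (hQ : 2 <= homogeneous_dim N)
  (E : 'M[R]_(q, d)) (E_free : row_free E)
  (E_first_layer : (E :=: eigenspace (sder N) 1)%MS)
  (z0 z1 : 'rV[R]_d) (u0 u1 : R) :
  (distG N E (z0, u0) (z1, u1) =
     arccoshe (((1 + expR (2 * (u1 - u0)))%:E
                + ((expR (- u0))%:E * distN N E z0 z1) ^+ 2)
               / (2 * expR (u1 - u0))%:E))%E /\
  (distG N E (z0, u0) (z1, u1) =
     arccoshe ((cosh (u0 - u1))%:E
               + (expR (- (u0 + u1)))%:E * distN N E z0 z1 ^+ 2 / 2%:E))%E.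
Proof.
(* frameG N E is by definition the warped frame of frameN N E *)
have main := warped_cc_dist (frameN N E) z0 z1 u0 u1.
split; last exact: main.
rewrite [LHS]main; congr arccoshe.
have e0 : 2 * expR (u1 - u0) != 0 by rewrite mulf_neq0 ?gt_eqF ?expR_gt0.
have := cc_dist_ge0 (frameN N E) z0 z1; rewrite /distN.
case: (cc_dist _ z0 z1) => [r _|_|//].
  rewrite !inver pnatr_eq0 (negPf e0)/=; congr EFin.
  exact: half_plane_cosh_quotient.
rewrite !expe2 !gt0_muley ?lte_fin ?expR_gt0// !inver pnatr_eq0 (negPf e0).
by rewrite !gt0_mulye ?lte_fin ?invr_gt0 ?mulr_gt0 ?expR_gt0// !addey.
Qed.
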